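(* Let $\mathfrak h_1,\mathfrak h_2$ be nonnegative sesquilinear forms in a complex Hilbert space $\mathfrak H$ with $\operatorname{dom}\mathfrak h_1=\operatorname{dom}\mathfrak h_2$ and sum $\mathfrak h=\mathfrak h_1+\mathfrak h_2$. Let $Q$ be a minimal representing map for the sum $\mathfrak h$, i.e. a linear operator from $\mathfrak H$ to a Hilbert space $\mathfrak K$ with $\operatorname{dom}Q=\operatorname{dom}\mathfrak h$, $\overline{\operatorname{ran}}\,Q=\mathfrak K$, and $$\mathfrak h[\varphi,\psi]=(Q\varphi,Q\psi),\qquad\varphi,\psi\in\operatorname{dom}\mathfrak h.$$ Let $K\in\mathbf B(\mathfrak K)$ be the nonnegative contraction for which $$\mathfrak h_1[\varphi,\psi]=((I-K)^{1/2}Q\varphi,(I-K)^{1/2}Q\psi),\qquad\mathfrak h_2[\varphi,\psi]=(K^{1/2}Q\varphi,K^{1/2}Q\psi),\qquad\varphi,\psi\in\operatorname{dom}\mathfrak h=\operatorname{dom}Q.$$ Then the parallel sum $\mathfrak h_1:\mathfrak h_2$ has the representation $$(\mathfrak h_1:\mathfrak h_2)[\varphi,\psi]=\big(((I-K):K)Q\varphi,Q\psi\big),\qquad\varphi,\psi\in\operatorname{dom}\mathfrak h=\operatorname{dom}Q.$$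
   Context: A (sesquilinear) form $\mathfrak h$ in $\mathfrak H$ is a map $\operatorname{dom}\mathfrak h\times\operatorname{dom}\mathfrak h\to\mathbb C$, linear in the first and antilinear in the second entry, where $\operatorname{dom}\mathfrak h$ is a (not necessarily dense) linear subspace of $\mathfrak H$; $\mathfrak h[\varphi]=\mathfrak h[\varphi,\varphi]$. It is nonnegative if $\mathfrak h[\varphi]\ge0$ on $\operatorname{dom}\mathfrak h$. A nonnegative contraction is a bounded everywhere defined selfadjoint operator $K$ on $\mathfrak K$ with $0\le K\le I$; a $K$ as in the claim always exists and, since $Q$ has dense range, is unique. The parallel sum of nonnegative forms $\mathfrak h_1,\mathfrak h_2$ with common domain $\operatorname{dom}\mathfrak h$ is the nonnegative form with domain $\operatorname{dom}\mathfrak h$ determined via polarization by $$(\mathfrak h_1:\mathfrak h_2)[\varphi]=\inf\{\mathfrak h_1[h+\varphi]+\mathfrak h_2[h]:\ h\in\operatorname{dom}\mathfrak h\},\qquad\varphi\in\operatorname{dom}\mathfrak h.$$ For nonnegative operators $A,B\in\mathbf B(\mathfrak K)$ the parallel sum $A:B\in\mathbf B(\mathfrak K)$ is determined via polarization by $$((A:B)\varphi,\varphi)=\inf\{(A(h+\varphi),h+\varphi)+(Bh,h):\ h\in\mathfrak K\},\qquad\varphi\in\mathfrak K.$$ *)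

(* Defs.v *)
From HB Require Import structures.
From mathcomp Require Import all_boot all_order all_algebra.
From mathcomp Require Import all_classical all_reals all_analysis.
From mathcomp Require Import complex.

Set Implicit Arguments.
Unset Strict Implicit.
Unset Printing Implicit Defensive.

Import Order.TTheory GRing.Theory Num.Theory.
Import numFieldNormedType.Exports.

Local Open Scope classical_set_scope.
Local Open Scope ring_scope.

(* [{dot H for conj}] is linear in the first and antilinear in the second
   variable. Norms of an [R[i]]-normed module take their values in [R[i]]. *)
HB.mixin Record isHilbert (R : realType) H of CompleteNormedModule R[i] H := {
  inner : {dot H for Num.conj};
  sqr_norm_inner : forall x : H, `|x| ^+ 2 = inner x x
}.

#[short(type="hilbertType")]
HB.structure Definition Hilbert (R : realType) :=
  {H of isHilbert R H & CompleteNormedModule R[i] H}.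

Notation "''[' x , y ]" := (inner x y)
  (format "''[' x ,  y ]")
  : ring_scope.

Section Forms.
Context {R : realType} {H : hilbertType R}.

(* The values of [form_fun] outside [form_dom] are irrelevant. *)
Record sesqForm := SesqForm {
  form_dom : set H;
  form_fun :> H -> H -> R[i];
  form_dom_submod : submod_closed (mem form_dom);
  form_linear : {in form_dom & &, forall x y z, forall a : R[i],
    form_fun (a *: x + y) z = a * form_fun x z + form_fun y z};
  form_antilinear : {in form_dom & &, forall x y z, forall a : R[i],
    form_fun x (a *: y + z) = a^* * form_fun x y + form_fun x z}
}.

Definition nonneg_form (h : sesqForm) := forall x, form_dom h x -> 0 <= h x x.

Lemma form_add_submod (h1 h2 : sesqForm) :
  submod_closed (mem (form_dom h1 `&` form_dom h2)).
Proof.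
have [z1 c1] := form_dom_submod h1; have [z2 c2] := form_dom_submod h2.
split=> [|a x y]; rewrite !in_setI; first by apply/andP; split.
move=> /andP[x1 x2] /andP[y1 y2].
by apply/andP; split; [exact: c1|exact: c2].
Qed.

Lemma form_add_linear (h1 h2 : sesqForm) (f := fun x y => h1 x y + h2 x y) :
  {in form_dom h1 `&` form_dom h2 & &, forall x y z, forall a : R[i],
    f (a *: x + y) z = a * f x z + f y z}.
Proof.
move=> x y z; rewrite !in_setI => /andP[x1 x2] /andP[y1 y2] /andP[? ?] a.
by rewrite /f !form_linear// mulrDr addrACA.
Qed.

Lemma form_add_antilinear (h1 h2 : sesqForm) (f := fun x y => h1 x y + h2 x y) :
  {in form_dom h1 `&` form_dom h2 & &, forall x y z, forall a : R[i],
    f x (a *: y + z) = a^* * f x y + f x z}.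
Proof.
move=> x y z; rewrite !in_setI => /andP[x1 x2] /andP[y1 y2] /andP[? ?] a.
by rewrite /f !form_antilinear// mulrDr addrACA.
Qed.

Definition form_add (h1 h2 : sesqForm) : sesqForm :=
  SesqForm (form_add_submod h1 h2)
    (@form_add_linear h1 h2) (@form_add_antilinear h1 h2).

(* For [q x = Re (h x x)] with [h] a nonnegative form, this is [h]. *)
Definition polarization (q : H -> R) (x y : H) : R[i] :=
  4%:R^-1 * \sum_(k < 4) 'i ^+ k * (q (x + 'i ^+ k *: y))%:C%C.

(* Meant for nonnegative forms with a common domain: the numbers [h x x] are
   then nonnegative reals, and [complex.Re] only reads them in [R]. *)
Definition parallel_sum_form (h1 h2 : sesqForm) : H -> H -> R[i] :=
  polarization (fun x =>
    inf [set complex.Re (h1 (h + x) (h + x) + h2 h h)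
        | h in form_dom h1 `&` form_dom h2]).

End Forms.
Arguments sesqForm {R} H.

Section Operators.
Context {R : realType} {G : hilbertType R}.

(* Membership in B(G). *)
Definition bounded_op (T : G -> G) := linear T /\ bounded_near T (nbhs (0 : G)).

Definition nonneg_op (T : G -> G) :=
  [/\ bounded_op T, forall x y, '[T x, y] = '[x, T y]
    & forall x, 0 <= '[T x, x]].

Definition nonneg_contraction (T : G -> G) :=
  nonneg_op T /\ forall x, '[T x, x] <= '[x, x].

(* The unique nonnegative square root of a nonnegative operator. *)
Definition sqrt_op (T : G -> G) : G -> G :=
  xget (fun=> 0) [set S | nonneg_op S /\ S \o S = T].

(* The unique P in B(G) with the prescribed quadratic form, for nonnegative
   operators A and B. *)
Definition parallel_sum_op (A B : G -> G) : G -> G :=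
  xget (fun=> 0) [set P | bounded_op P /\ forall x, '[P x, x] =
    (inf [set complex.Re ('[A (h + x), h + x] + '[B h, h]) | h in setT])%:C%C].

End Operators.

Section RepresentingMaps.
Context {R : realType}.

(* The values of [op_fun] outside [op_dom] are irrelevant. *)
Record linOperator (H G : hilbertType R) := LinOperator {
  op_dom : set H;
  op_fun :> H -> G;
  op_dom_submod : submod_closed (mem op_dom);
  op_linear : {in op_dom &, forall x y, forall a : R[i],
    op_fun (a *: x + y) = a *: op_fun x + op_fun y}
}.

Definition minimal_representing_map (H G : hilbertType R) (h : sesqForm H)
    (Q : linOperator H G) :=
  [/\ op_dom Q = form_dom h,
      closure (Q @` op_dom Q) = setT &
      forall x y, form_dom h x -> form_dom h y -> h x y = '[Q x, Q y]].

End RepresentingMaps.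

(* Main.v *)
From HB Require Import structures.
Require Import Defs.
From mathcomp Require Import all_boot all_order all_algebra.
From mathcomp Require Import all_classical all_reals all_analysis.
From mathcomp Require Import complex.
From mathcomp Require Import ring.

(* With [u = Q h], the functional minimized by [h1 : h2] at [x] is, by completing
   the square, [|u + (I - K) Q x|^2 + ((K - K^2) Q x, Q x)]. Since [ran Q] is
   dense, its infimum is [((K - K^2) Q x, Q x)], the same as over the whole of
   [G]; hence [(I - K) : K = K - K^2], and polarization concludes. *)

Set Implicit Arguments.
Unset Strict Implicit.
Unset Printing Implicit Defensive.

Import Order.TTheory GRing.Theory Num.Theory.
Import numFieldNormedType.Exports.

Local Open Scope classical_set_scope.
Local Open Scope ring_scope.

Section HilbertSpace.
Context {R : realType} {G : hilbertType R}.
Implicit Types (x y u w : G) (D : set G) (T P A B : G -> G).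

Lemma innerC x y : '[x, y] = '[y, x]^*.
Proof. by rewrite hermC expr0 mul1r. Qed.

Lemma innerDl x y u : '[x + y, u] = '[x, u] + '[y, u].
Proof. exact: linearDl. Qed.

Lemma innerDr x y u : '[u, x + y] = '[u, x] + '[u, y].
Proof. exact: linearDr. Qed.

Lemma innerBl x y u : '[x - y, u] = '[x, u] - '[y, u].
Proof. exact: linearBl. Qed.

Lemma innerBr x y u : '[u, x - y] = '[u, x] - '[u, y].
Proof. exact: linearBr. Qed.

Lemma innerZl (c : R[i]) x y : '[c *: x, y] = c * '[x, y].
Proof. exact: linearZl_LR. Qed.

Lemma innerZr (c : R[i]) x y : '[x, c *: y] = c^* * '[x, y].
Proof. exact: linearZr_LR. Qed.

Lemma norm_le_Pythagoras x y : '[x, y] = 0 -> `|x| <= `|x - y|.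
Proof.
move=> xy0; rewrite -(@ler_pXn2r _ 2)// ?nnegrE// !sqr_norm_inner.
by rewrite hnormBd// lerDl dnorm_ge0.
Qed.

Lemma dense_approx D w (e : R[i]) : closure D = setT -> 0 < e ->
  exists2 u, D u & `|w - u| < e.
Proof.
move=> dD e0; have : closure D w by rewrite dD.
by move=> /(_ _ (nbhsx_ballx w e e0))[u [Du]]; rewrite -ball_normE; exists u.
Qed.

(** For [u] in [D] within [e] of [w], orthogonality and Pythagoras give [|w| <= |w - u| < e]. *)
Lemma dense_orthogonal_eq0 D w :
  closure D = setT -> (forall u, D u -> '[w, u] = 0) -> w = 0.
Proof.
move=> dD w0; apply/eqP; rewrite -normr_le0; apply/ler_addgt0Pr => e e0.
have [u Du wu] := dense_approx w dD e0.
by rewrite add0r (le_trans (norm_le_Pythagoras (w0 _ Du)))// ltW.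
Qed.

(** Density is used twice: [T v] is orthogonal to [D] for [v] in [D], hence zero; by symmetry every
    [T x] is then orthogonal to [D]. *)
Lemma selfadjoint_eq0_dense T D :
  (forall x y, '[T x, y] = '[x, T y]) -> closure D = setT ->
  (forall u v, D u -> D v -> '[T u, v] = 0) -> forall x, T x = 0.
Proof.
move=> saT dD T0 x; apply: (dense_orthogonal_eq0 dD) => v Dv.
rewrite saT [T v](@dense_orthogonal_eq0 D)//; first by rewrite linear0r.
by move=> u Du; rewrite T0.
Qed.

Lemma polarization_inner P x y : linear P ->
  4%:R^-1 * \sum_(k < 4)
    'i ^+ k * '[P (x + 'i ^+ k *: y), x + 'i ^+ k *: y] = '[P x, y].
Proof.
move=> linP.
(* At [c = 'i ^+ k] one has [c * c^* = 1]. Weighted by [c] and summed over [k], the term in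
   ['[P x, y]] contributes 4 times itself; the others cancel, as the sums of [c] and of [c ^+ 2]
   vanish. *)
have expand (c : R[i]) : '[P (x + c *: y), x + c *: y] =
    '[P x, x] + c^* * '[P x, y] + c * '[P y, x] + c * c^* * '[P y, y].
  rewrite [x + _]addrC linP !(innerDl, innerDr, innerZl, innerZr); ring.
have i2 : 'i * 'i = -1 :> R[i] by rewrite -expr2 sqrCi.
rewrite !big_ord_recl big_ord0 /= !expand /bump /= !exprS expr0 !mulr1 i2.
rewrite mulrN1 rmorph1 !rmorphN rmorph1 /= conjCi.
by rewrite opprK; field: i2.
Qed.

Lemma linear_eq_quadratic T P : linear T -> linear P ->
  (forall x, '[T x, x] = '[P x, x]) -> forall x y, '[T x, y] = '[P x, y].
Proof.
move=> linT linP eqTP x y.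
rewrite -(polarization_inner x y linT) -(polarization_inner x y linP).
by under eq_bigr do rewrite eqTP.
Qed.

Section Contraction.
Variable K : G -> G.
Hypothesis linK : linear K.
Hypothesis saK : forall x y, '[K x, y] = '[x, K y].

(* Completing the square: the minimum is attained at [u = - (I - K) x]. *)
Lemma parallel_sum_complete_square x u :
  '[(idfun \- K) (u + x), u + x] + '[K u, u]
  = `|u + (x - K x)| ^+ 2 + '[(K \- (K \o K)) x, x].
Proof.
have KD : K (u + x) = K u + K x by rewrite -[u]scale1r linK !scale1r.
rewrite sqr_norm_inner /= KD.
by rewrite !(innerBl, innerBr, innerDl, innerDr) !saK; ring.
Qed.

(** The squared distance from [- (x - K x)] to a dense set is 0. Taking [D = setT] serves the
    operator, and [D = ran Q] the form. *)
Lemma inf_parallel_sum_dense x D : closure D = setT ->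
  (inf [set complex.Re ('[(idfun \- K) (u + x), u + x] + '[K u, u])
       | u in D])%:C%C
  = '[(K \- (K \o K)) x, x].
Proof.
(* By symmetry of [K] the right-hand side is real, so the comparison can be made in [R]. *)
move=> dD; rewrite -['[_, x] in RHS]RRe_real; last first.
  by apply/CrealP; rewrite -innerC /= innerBl innerBr !saK.
congr (_%:C)%C; set c := complex.Re '[_, x]; set S := [set _ | _ in _].
have lbS : lbound S c.
  move=> _ [u _ <-]; rewrite parallel_sum_complete_square raddfD /= lerDr.
  by have := exprn_ge0 2 (normr_ge0 (u + (x - K x))); rewrite lecE => /andP[].
apply/eqP; rewrite eq_le; apply/andP; split; last first.
  apply: lb_le_inf => //.
  have [u Du _] := dense_approx 0 dD (@ltr01 R[i]).
  by eexists; exists u.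
apply/ler_addgt0Pr => e e0.
(* Approximating within [sqrt e] leaves a squared norm below [e]. *)
have se0 : 0 < (Num.sqrt e)%:C%C :> R[i] by rewrite ltcR sqrtr_gt0.
have [u Du] := dense_approx (- (x - K x)) dD se0.
rewrite -opprD normrN => ue.
apply: (@le_trans _ _ (complex.Re
    ('[(idfun \- K) (u + x), u + x] + '[K u, u]))).
  by apply: ge_inf; [exists c|exists u].
rewrite parallel_sum_complete_square raddfD /= addrC lerD2l.
have /ltW : `|u + (x - K x)| ^+ 2 < (Num.sqrt e)%:C%C ^+ 2.
  by rewrite ltr_pXn2r ?nnegrE ?(ltW se0)// addrC.
by rewrite -rmorphXn (sqr_sqrtr (ltW e0)) lecE => /andP[].
Qed.

(** This makes [K - K^2] a candidate in the choice defining [parallel_sum_op]. *)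
Lemma parallel_sum_bounded_op : bounded_near K (nbhs (0 : G)) ->
  bounded_op (K \- (K \o K)).
Proof.
pose KL := GRing.isLinear.Build _ _ _ _ K linK.
pose f : {linear G -> G} := HB.pack K KL.
move=> /(linear_boundedP f) [M [Mreal HM]].
have lin : linear (K \- (K \o K)).
  move=> a x y /=; rewrite !linK scalerBr opprD addrACA; congr (_ + _).
split=> //.
pose gL := GRing.isLinear.Build _ _ _ _ (K \- (K \o K)) lin.
pose g : {linear G -> G} := HB.pack (K \- (K \o K)) gL.
apply/(linear_boundedP g).
(* [HM] accepts any constant above [M]; this one is also nonnegative, so the bound can be iterated
   for [K \o K]. *)
pose r := `|M| + 1.
have Kr x : `|K x| <= r * `|x|.
  by apply: HM; rewrite (le_lt_trans (real_ler_norm Mreal))// ltrDl.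
have r0 : 0 <= r by rewrite addr_ge0.
exists (r + r * r); split; first by rewrite ger0_real// addr_ge0// mulr_ge0.
move=> N /ltW rN x; apply: (le_trans (ler_normB _ _)).
apply: (@le_trans _ _ ((r + r * r) * `|x|)); last by rewrite ler_wpM2r.
rewrite mulrDl lerD// -mulrA (le_trans (Kr _))//.
by rewrite ler_wpM2l.
Qed.

Lemma parallel_sum_opE x y : bounded_near K (nbhs (0 : G)) ->
  '[parallel_sum_op (idfun \- K) K x, y] = '[(K \- (K \o K)) x, y].
Proof.
move=> bK; have bP := parallel_sum_bounded_op bK.
rewrite /parallel_sum_op; set S := [set P | _].
have dT : closure [set: G] = setT by rewrite closureT.
(* Since [K - K^2] inhabits [S], [xget] returns a member of [S] rather than its default;
   polarization then identifies the two operators. *)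
have [[linP _] P_eq] : S (xget (fun=> 0) S).
  by apply: xgetPex; exists (K \- (K \o K)); split=> // z; rewrite inf_parallel_sum_dense.
by apply: linear_eq_quadratic => // [|z]; [case: bP|rewrite P_eq inf_parallel_sum_dense].
Qed.

End Contraction.

Lemma sqrt_op_inner_or_junk T :
  (forall x y, '[sqrt_op T x, sqrt_op T y] = '[T x, y])
  \/ sqrt_op T = (fun=> 0).
Proof.
rewrite /sqrt_op.
case: (xgetP (fun=> 0 : G) [set S | nonneg_op S /\ S \o S = T]).
  by move=> _ -> [[_ saS _] {3}<-]; left=> x y; rewrite [RHS]saS.
by move=> _; right.
Qed.

(* The existence of the square roots is not needed: if [A] has none, then
   [sqrt_op A] is [0] and the identity assumed on [D] forces [A = 0]. *)
Lemma sqrt_op_inner A B D : (forall x y, '[A x, y] = '[x, A y]) ->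
  (forall x, A x + B x = x) -> closure D = setT ->
  (forall u v, D u -> D v ->
    '[sqrt_op A u, sqrt_op A v] + '[sqrt_op B u, sqrt_op B v] = '[u, v]) ->
  forall x y, '[sqrt_op A x, sqrt_op A y] = '[A x, y].
Proof.
move=> saA AB dD AD x y.
have [//|A0] := sqrt_op_inner_or_junk A.
have BD u v : D u -> D v -> '[sqrt_op B u, sqrt_op B v] = '[u, v].
  by move=> Du Dv; rewrite -(AD u v)// A0 linear0l add0r.
suff -> : A x = 0 by rewrite A0 !linear0l.
have [SB|B0] := sqrt_op_inner_or_junk B.
  (* On [D] the form of [B] is the inner product itself, so [A + B = I] leaves nothing for [A]. *)
  apply: (selfadjoint_eq0_dense saA dD) => u v Du Dv.
  by apply: (addIr '[B u, v]); rewrite -innerDl AB add0r -SB BD.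
(* Both roots are 0 here, so the inner product vanishes on [D] and the space is trivial. *)
apply: (@selfadjoint_eq0_dense idfun D) => // u v Du Dv.
by rewrite -(BD u v)// B0 linear0l.
Qed.

End HilbertSpace.

Theorem proposition4p4 (R : realType) (H G : hilbertType R)
    (h1 h2 : sesqForm H) (Q : linOperator H G) (K : G -> G)
    (h1_ge0 : nonneg_form h1) (h2_ge0 : nonneg_form h2)
    (dom_eq : form_dom h1 = form_dom h2)
    (repQ : minimal_representing_map (form_add h1 h2) Q)
    (contrK : nonneg_contraction K)
    (h1K : forall x y, op_dom Q x -> op_dom Q y ->
      h1 x y = '[sqrt_op (idfun \- K) (Q x), sqrt_op (idfun \- K) (Q y)])
    (h2K : forall x y, op_dom Q x -> op_dom Q y ->
      h2 x y = '[sqrt_op K (Q x), sqrt_op K (Q y)]) :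
  forall x y, op_dom Q x -> op_dom Q y ->
    parallel_sum_form h1 h2 x y
    = '[parallel_sum_op (idfun \- K) K (Q x), Q y].
Proof.
have [domQ dQ reprQ] := repQ.
have domQ1 : op_dom Q = form_dom h1 by rewrite domQ /= -dom_eq setIid.
have [[[linK bK] saK _] _] := contrK.
have saIK u v : '[(idfun \- K) u, v] = '[u, (idfun \- K) v].
  by rewrite /= innerBl innerBr saK.
(* On [ran Q] the two root forms add up to [h1 + h2], which [Q] represents by the inner product. *)
have sqrtD u v : (Q @` op_dom Q) u -> (Q @` op_dom Q) v ->
    '[sqrt_op (idfun \- K) u, sqrt_op (idfun \- K) v]
    + '[sqrt_op K u, sqrt_op K v] = '[u, v].
  by move=> [a aD <-] [b bD <-]; rewrite -h1K// -h2K// -reprQ// -domQ.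
have h1E x y : op_dom Q x -> op_dom Q y ->
    h1 x y = '[(idfun \- K) (Q x), Q y].
  move=> Dx Dy; rewrite h1K//; apply: (sqrt_op_inner saIK _ dQ sqrtD) => u.
  exact: subrK.
have h2E x y : op_dom Q x -> op_dom Q y -> h2 x y = '[K (Q x), Q y].
  move=> Dx Dy; rewrite h2K//.
  apply: (@sqrt_op_inner _ _ _ (idfun \- K) _ saK _ dQ) => [u|u v Du Dv].
    by rewrite /= addrC subrK.
  by rewrite addrC sqrtD.
have domD a x y : op_dom Q x -> op_dom Q y -> op_dom Q (x + a *: y).
  have [_ cQ] := op_dom_submod Q => Dx Dy.
  by rewrite addrC; apply/set_mem/cQ; exact/mem_set.
have QD a x y : op_dom Q x -> op_dom Q y -> Q (x + a *: y) = Q x + a *: Q y.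
  by move=> Dx Dy; rewrite addrC op_linear 1?addrC//; exact/mem_set.
have infE x : op_dom Q x ->
    (inf [set complex.Re (h1 (h + x) (h + x) + h2 h h)
         | h in form_dom h1 `&` form_dom h2])%:C%C
    = '[parallel_sum_op (idfun \- K) K (Q x), Q x].
  move=> Dx; rewrite parallel_sum_opE// -(inf_parallel_sum_dense linK saK _ dQ).
  (* Substituting [u = Q h] turns the infimum over [ran Q] into one over the common domain. *)
  congr (inf _)%:C%C; rewrite image_comp -dom_eq setIid.
  rewrite -domQ1; apply: eq_imagel => h Dh /=.
  have Qhx : Q (h + x) = Q h + Q x by rewrite -[x]scale1r QD// !scale1r.
  by rewrite h1E ?h2E ?Qhx//=; rewrite -[x]scale1r; exact: domD.
have [linP _] := parallel_sum_bounded_op linK bK.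
move=> x y Dx Dy.
rewrite parallel_sum_opE// -(polarization_inner _ _ linP).
congr (_ * _); apply: eq_bigr => k _; congr (_ * _).
by rewrite infE ?QD ?parallel_sum_opE//; exact: domD.
Qed.
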